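(* Let $K$ be a field of characteristic zero and let $1\le k\le n$ be integers. Then the algebra morphism $\mathrm{Res}_k^n:K\Sigma'(W_n)\to K\Sigma'(W_k)$ is surjective.
   Context: $W_n$ is the group of permutations $\sigma$ of $I_n=\{\pm1,\dots,\pm n\}$ with $\sigma(-i)=-\sigma(i)$. It acts on $\mathbb{R}^n$ (canonical basis $e_1,\dots,e_n$, $e_{-i}=-e_i$) by $\sigma(e_i)=e_{\sigma(i)}$, and is the Weyl group of $\Phi_n=\{\pm 2e_i\}\cup\{\pm e_i\pm e_j : i<j\}$ with basis $\{2e_1,e_2-e_1,\dots,e_n-e_{n-1}\}$; $\Phi_n^+$ is the set of positive roots, and $\alpha>0$ means $\alpha\in\Phi_n^+$. For a root $\alpha$, $s_\alpha\in W_n$ is the reflection in $\alpha$. A signed composition of $n$ is a finite sequence $C=(c_1,\dots,c_r)$ of non-zero integers with $\sum|c_i|=n$; $\mathrm{Comp}(n)$ is the set of these. Let $I_{C,+}^{(i)}=\{k\in\mathbb{N}: |c_1|+\dots+|c_{i-1}|+1\le k\le |c_1|+\dots+|c_i|\}$, $I_C^{(i)}=I_{C,+}^{(i)}$ if $c_i<0$ and $I_C^{(i)}=I_{C,+}^{(i)}\cup -I_{C,+}^{(i)}$ if $c_i>0$, and $W_C=\{w\in W_n : w(I_C^{(i)})=I_C^{(i)}\ \forall i\}$. Let $\Phi_C=\{\alpha\in\Phi_n: s_\alpha\in W_C\}$, $\Phi_C^+=\Phi_C\cap\Phi_n^+$, $X_C=\{w\in W_n: w(\alpha)>0\ \forall\alpha\in\Phi_C^+\}$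 and $x_C=\sum_{w\in X_C}w\in KW_n$. The $x_C$ are linearly independent and $K\Sigma'(W_n)=\bigoplus_{C}Kx_C$ is a unital subalgebra of $KW_n$ (Mantaci-Reutenauer algebra). Let $D=(k,-1,-1,\dots,-1)\in\mathrm{Comp}(n)$ (with $n-k$ parts equal to $-1$); then $W_D$ is the subgroup of $W_n$ fixing $k+1,\dots,n$, identified with $W_k$. For $C\in\mathrm{Comp}(n)$ let $X_{CD}=X_C^{-1}\cap X_D$. For $d\in X_{CD}$, $d^{-1}W_Cd\cap W_D=W_{C_d\sqcup(-1,\dots,-1)}$ for a unique $C_d\in\mathrm{Comp}(k)$, where $\sqcup$ denotes concatenation. Then $\mathrm{Res}_k^n$ is the $K$-linear map with $\mathrm{Res}_k^n(x_C)=\sum_{d\in X_{CD}}x_{C_d}$; it is a morphism of algebras. *)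

(* Defs.v *)
From HB Require Import structures.
From mathcomp Require Import all_boot all_order all_fingroup all_algebra.

Set Implicit Arguments.
Unset Strict Implicit.
Unset Printing Implicit Defensive.

Import Order.TTheory GRing.Theory Num.Theory.
Local Open Scope ring_scope.

(* The set I_n = {±1, ..., ±n}: (false, i) stands for i + 1 and (true, i)     *)
(* for -(i + 1).                                                              *)
Definition sidx (n : nat) : finType := (bool * 'I_n)%type.

Definition sopp n (p : sidx n) : sidx n := (~~ p.1, p.2).

(* Permutations compose from left to right in the library,                    *)
(* (s * t) p = t (s p), whereas the mathematical convention for W_n is        *)
(* s t = s o t.  Only inverses and conjugates of subgroups occur below.       *)
Definition Wset n : {set {perm sidx n}} :=
  [set w : {perm sidx n} | [forall p, w (sopp p) == sopp (w p)]].

Lemma Wset_group_set n : group_set (Wset n).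
Proof.
apply/group_setP; split=> [|s t].
  by rewrite inE; apply/forallP=> p; rewrite !perm1.
rewrite !inE => /forallP Hs /forallP Ht; apply/forallP=> p.
by rewrite !permM (eqP (Hs p)) (eqP (Ht _)).
Qed.

Canonical Wgroup n := Group (Wset_group_set n).

(* Roots have integer coordinates; R^n is replaced by Q^n so that membership  *)
(* and positivity are decidable.                                              *)
Definition evec n (p : sidx n) : 'rV[rat]_n := (-1) ^+ p.1 *: delta_mx 0 p.2.

(* w acts on row vectors by v |-> v *m Wmx w, which sends e_p to e_(w p).     *)
Definition Wmx n (w : {perm sidx n}) : 'M[rat]_n :=
  \matrix_i evec (w (false, i)).

Definition type_C_roots n : seq 'rV[rat]_n :=
  [seq evec p *+ 2 | p : sidx n] ++
  [seq evec pq.1 + evec pq.2 |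
    pq : sidx n * sidx n <- enum {: sidx n * sidx n} &
      (nat_of_ord pq.1.2 < nat_of_ord pq.2.2)%N].

(* The basis 2 e_1, e_2 - e_1, ..., e_n - e_(n-1).                            *)
Definition simple_root n (i : 'I_n) : 'rV[rat]_n :=
  if i == 0%N :> nat then evec (false, i) *+ 2
  else evec (false, i) - evec (false, ord_pred i).

Definition simple_roots n : n.-tuple 'rV[rat]_n := [tuple simple_root i | i < n].

Definition pos_root n (a : 'rV[rat]_n) : bool :=
  (a \in type_C_roots n) && [forall i, 0 <= coord (simple_roots n) i a].

Definition dotv n (a b : 'rV[rat]_n) : rat := \sum_i a 0 i * b 0 i.

(* Matrix of v |-> v - 2 (v, a) / (a, a) a, acting on row vectors.            *)
Definition refl_mx n (a : 'rV[rat]_n) : 'M[rat]_n :=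
  \matrix_i (delta_mx 0 i - (2 * dotv (delta_mx 0 i) a / dotv a a) *: a).

Definition is_scomp (n : nat) (C : seq int) : bool :=
  all (fun c => c != 0) C && (sumn [seq `|c|%N | c <- C] == n).

Record scomp (n : nat) := SComp { scomp_val :> seq int; _ : is_scomp n scomp_val }.

HB.instance Definition _ n := [isSub for @scomp_val n].
HB.instance Definition _ n := [Choice of scomp n by <:].

(* Finiteness: at most n parts, each of them in {-n, ..., n}.                 *)
Definition scomp_code n (C : scomp n) : n.-bseq (bool * 'I_n.+1) :=
  insub_bseq n [seq ((c < 0)%R, inord `|c|%N) | c <- scomp_val C].

Definition scomp_decode n (s : n.-bseq (bool * 'I_n.+1)) : option (scomp n) :=
  insub [seq (-1) ^+ u.1 * (u.2 : nat)%:Z | u : bool * 'I_n.+1 <- s].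

Lemma scomp_codeK n : pcancel (@scomp_code n) (@scomp_decode n).
Proof.
case=> C HC; rewrite /scomp_decode /scomp_code /=.
have [Cn0 sC] : all (fun c => c != 0) C /\ sumn [seq `|c|%N | c <- C] = n.
  by case/andP: HC => ? /eqP.
have szC : (size C <= n)%N.
  rewrite -sC; elim: (C) Cn0 => //= c s IHs /andP[c0 /IHs]; rewrite -absz_gt0 in c0.
  by move=> le_s; apply: (leq_add c0 le_s).
have leC c : c \in C -> (`|c| <= n)%N.
  rewrite -sC; elim: (C) => //= b s IHs; rewrite inE => /predU1P[->|/IHs le_c].
    exact: leq_addr.
  exact: leq_trans le_c (leq_addl _ _).
have -> : [seq (-1) ^+ u.1 * (u.2 : nat)%:Z
            | u : bool * 'I_n.+1 <- insub_bseq n [seq ((c < 0)%R, inord `|c|%N : 'I_n.+1) | c <- C]] = C.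
  rewrite /insub_bseq val_insubd size_map szC -map_comp -[RHS]map_id.
  apply/eq_in_map=> c /leC le_c /=.
  by rewrite inordK ?ltnS // -intEsign.
by rewrite insubT.
Qed.

HB.instance Definition _ n := Countable.copy (scomp n) (pcan_type (@scomp_codeK n)).
HB.instance Definition _ n : isFinite (scomp n) := PCanIsFinite (@scomp_codeK n).

(* I_C^(i); parts are numbered from 0 and (b, j) has absolute value j + 1.    *)
Definition block n (C : seq int) (i : nat) : {set sidx n} :=
  let c := C`_i in
  let off := sumn [seq `|b|%N | b <- take i C] in
  let Ipos := [set p : sidx n | ~~ p.1 & (off + 1 <= p.2.+1 <= off + `|c|)%N] in
  if c < 0 then Ipos else Ipos :|: [set sopp p | p in Ipos].

Definition WC n (C : seq int) : {set {perm sidx n}} :=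
  [set w in Wset n | [forall i : 'I_(size C), w @: block n C i == block n C i]].

Definition in_PhiC n (C : seq int) (a : 'rV[rat]_n) : bool :=
  (a \in type_C_roots n) && [exists w in WC n C, Wmx w == refl_mx a].

Definition XC n (C : seq int) : {set {perm sidx n}} :=
  [set w in Wset n |
    all (fun a => pos_root (a *m Wmx w))
        [seq a <- type_C_roots n | in_PhiC C a & pos_root a]].

(* The vector space of the group algebra K W_n.                               *)
Definition KW (K : fieldType) (n : nat) := {ffun [subg Wset n] -> K^o}.

Definition xC (K : fieldType) n (C : seq int) : KW K n :=
  [ffun w => (sgval w \in XC n C)%:R].

Definition x_tuple (K : fieldType) n : #|{: scomp n}|.-tuple (KW K n) :=
  codom_tuple (fun C : scomp n => xC K n C).

(* K Sigma'(W_n), as a subspace of K W_n.                                     *)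
Definition MR (K : fieldType) n : {vspace KW K n} := <<x_tuple K n>>%VS.

Definition Dcomp (n k : nat) : seq int := k%:Z :: nseq (n - k) (-1).

Definition XCD n (C D : seq int) : {set {perm sidx n}} := (XC n C)^-1%g :&: XC n D.

(* The signed composition C_d.  With the library's composition order,         *)
(* WC n C :^ d^-1 consists of the maps d^-1 o w o d.                          *)
Definition Cd n k (C : seq int) (d : {perm sidx n}) : option (scomp k) :=
  [pick C' : scomp k |
    WC n (C' ++ nseq (n - k) (-1)) == (WC n C :^ d^-1)%g :&: WC n (Dcomp n k)].

Definition resC (K : fieldType) n k (C : seq int) : KW K k :=
  \sum_(d in XCD n C (Dcomp n k)) (if @Cd n k C d is Some C' then xC K k C' else 0).

(* The x_C form a basis of K Sigma'(W_n), so that coord (x_tuple K n) gives   *)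
(* the coordinates in the x_C, and Res is the linear map with                 *)
(* x_C |-> resC C.  The values lie in the span of the x_C', where vsproj is   *)
(* the identity.                                                              *)
Definition Res (K : fieldType) n k (v : subvs_of (MR K n)) : subvs_of (MR K k) :=
  vsproj (MR K k)
    (\sum_(C : scomp n)
       coord (x_tuple K n) (enum_rank C) (vsval v) *: resC K n k C).

Lemma Res_is_linear (K : fieldType) n k : linear (@Res K n k).
Proof.
move=> a u v; rewrite /Res -linearP; congr vsproj.
rewrite scaler_sumr -big_split; apply: eq_bigr => C _ /=.
by rewrite !linearP /= scalerDl scalerA.
Qed.

HB.instance Definition _ (K : fieldType) n k :=
  GRing.isLinear.Build K (subvs_of (MR K n)) (subvs_of (MR K k)) _ _
    (@Res_is_linear K n k).

(* Main.v *)
Require Import Defs.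
From mathcomp Require Import all_boot all_order all_fingroup all_algebra.
From mathcomp Require Import zify ring lra.

(** Write C+ for a signed composition C of k followed by n - k parts -1, so
    that W_(C+) is W_C inside W_n.  Surjectivity holds because Res is triangular
    on the elements x_(C+), with positive integers on the diagonal.

    The term of Res x_(C+) at d comes from the intersection of d^-1 W_(C+) d
    and W_D, where d is in X_D.  Such a d maps 1, ..., k to an increasing
    sequence of positive integers, so |d(i)| >= |i| when |i| <= k: conjugation
    by d carries the points moved by W_(C_d) to points moved by W_(C+) which
    are at least as far from the origin.  Weigh a subgroup by the sum of |p|
    over the ordered pairs (p, q) of distinct points in the same orbit.  Then
    W_(C_d) weighs at most as much as W_C, and in the case of equality d fixes
    every point moved by W_(C_d), the two subgroups agree and C_d = C; this is
    [Mackey_weight_lt].  The term at d = 1 is x_C.  Hence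
    Res x_(C+) = m x_C + (a combination of lighter x_C'), with m >= 1
    invertible in characteristic 0, and [xC_span_res] is an induction on the
    weight.

    Two facts connect this with the definitions.  First, W_C is the stabiliser
    in W_n of an equivalence relation on the signed points, whose classes are
    the orbits of W_C, and X_C is the set of the w which are increasing on each
    class for the order -n < ... < -1 < 1 < ... < n; this is [XCP], where
    every root is written e_q - e_p and its reflection exchanges p and q.  After
    it only these relations matter.  Second, Res is given by coordinates in the
    x_C, so that the x_C have to be linearly independent ([x_tuple_free]).  For
    each C there is w in X_C with as many descents as possible: it takes
    positive values exactly on the positive blocks and decreases from each
    block to any later block of the same sign.  If w also lies in X_C', then
    the positive part of C' is contained in that of C, and C' refines C if both
    are equal; this triangularity gives independence. *)

Set Implicit Arguments.
Unset Strict Implicit.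
Unset Printing Implicit Defensive.

Import Order.TTheory GRing.Theory Num.Theory.
Local Open Scope ring_scope.

(** * Blocks of a signed composition and the classes of W_C *)

(** The argument x stands for the points of absolute value x + 1.  Beyond the
    last block the value is the number of blocks. *)
Fixpoint block_index (C : seq int) (x : nat) : nat :=
  if C is c :: C1 then if (x < `|c|)%N then 0%N else (block_index C1 (x - `|c|)).+1
  else 0%N.

(** The relation of lying in the same orbit of W_C: within a negative block the
    group permutes the positive points and the negative points separately. *)
Definition same_class n (C : seq int) (p q : sidx n) : bool :=
  (block_index C p.2 == block_index C q.2) && ((p.1 == q.1) || (0 < C`_(block_index C p.2))).

Definition signed_val n (p : sidx n) : int :=
  if p.1 then - (p.2.+1)%:Z else (p.2.+1)%:Z.

Lemma block_index_eq C x i : (i < size C)%N ->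
  (block_index C x == i) =
  (sumn [seq `|b|%N | b <- take i C] <= x
     < sumn [seq `|b|%N | b <- take i C] + `|(C`_i)%R|)%N.
Proof.
elim: C x i => //= c C IHC x [_|i lt_i] /=.
  by case: ltnP.
case: ltnP => [lt_x|le_x]; first by apply/esym/negbTE; lia.
rewrite eqSS IHC //; lia.
Qed.

Lemma block_index_lt C x : (x < sumn [seq `|b|%N | b <- C])%N -> (block_index C x < size C)%N.
Proof.
elim: C x => //= c C IHC x lt_x; case: (ltnP x) => // le_x.
by rewrite ltnS IHC //; lia.
Qed.

Lemma leq_block_index C x y : (x <= y)%N -> (y < sumn [seq `|b|%N | b <- C])%N ->
  (block_index C x <= block_index C y)%N.
Proof.
elim: C x y => //= c C IHC x y le_xy lt_y.
case: (ltnP x) => // le_cx; case: (ltnP y) => [|le_cy]; first lia.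
by rewrite ltnS IHC; lia.
Qed.

Section Blocks.

Variables (n : nat) (C : seq int).
Hypothesis HC : is_scomp n C.

Lemma scomp_sum : sumn [seq `|b|%N | b <- C] = n.
Proof. by case/andP: HC => _ /eqP. Qed.

Lemma scomp_neq0 i : (i < size C)%N -> C`_i != 0.
Proof. by case/andP: HC => /allP H _ lt_i; apply/H/mem_nth. Qed.

Lemma block_index_ord (x : 'I_n) : (block_index C x < size C)%N.
Proof. by apply: block_index_lt; rewrite scomp_sum. Qed.

Lemma soppK : involutive (@sopp n).
Proof. by case=> b x; rewrite /sopp /= negbK. Qed.

Lemma in_block (p : sidx n) i : (i < size C)%N ->
  (p \in block n C i) = (block_index C p.2 == i) && (~~ p.1 || (0 < C`_i)).
Proof.
move=> lt_i; rewrite /block (block_index_eq _ lt_i).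
move: (sumn _) (C`_i) (scomp_neq0 lt_i) => off c c_neq0.
have in_pos (q : sidx n) : (q \in [set p : sidx n | ~~ p.1 &
    (off + 1 <= p.2.+1 <= off + `|c|)%N]) = ~~ q.1 && (off <= q.2 < off + `|c|)%N.
  by rewrite inE; congr (_ && _); lia.
case: ifP => c_lt0.
  have -> : (0 < c) = false by lia.
  rewrite in_pos orbF andbC //.
have -> : (0 < c) = true by lia.
rewrite orbT andbT inE (can2_imset_pre _ soppK soppK) in_pos [in X in _ || X]inE in_pos /=.
by case: (p.1) => /=; rewrite ?orbF.
Qed.

Lemma same_class_refl (p : sidx n) : same_class C p p.
Proof. by rewrite /same_class !eqxx. Qed.

Lemma same_class_sym (p q : sidx n) : same_class C p q = same_class C q p.
Proof.
by rewrite /same_class eq_sym; case: eqP => //= ->; rewrite [p.1 == _]eq_sym.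
Qed.

Lemma same_class_opp (p q : sidx n) : same_class C (sopp p) (sopp q) = same_class C p q.
Proof. by rewrite /same_class /=; congr (_ && (_ || _)); case: (p.1) (q.1) => [] []. Qed.

(** A negative block holds positive points only, so that a negative point has to
    be located through its opposite. *)
Lemma same_classP (p q : sidx n) : reflect
  (forall i, (i < size C)%N -> (p \in block n C i) = (q \in block n C i) /\
     (sopp p \in block n C i) = (sopp q \in block n C i))
  (same_class C p q).
Proof.
apply: (iffP idP) => [/andP[/eqP eq_i H] i lt_i|H].
  rewrite !in_block //= -eq_i.
  case: eqP => //= <-; case/orP: H => [/eqP->|->]; rewrite ?orbT //.
have [] := H _ (block_index_ord p.2); rewrite !in_block ?block_index_ord //= !eqxx /=.
rewrite /same_class eq_sym; case: eqP => [->|_] /=.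
  by case: (p.1) (q.1) => [] [] //= ->.
by case: (p.1) => //= ->.
Qed.

Lemma WsetP (w : {perm sidx n}) :
  reflect (forall p, w (sopp p) = sopp (w p)) (w \in Wset n).
Proof. by rewrite inE; apply: (iffP forallP) => H p; apply/eqP. Qed.

(** A permutation stabilises every block exactly when it never changes which
    blocks a point and its opposite belong to. *)
Lemma WCP (w : {perm sidx n}) :
  reflect (w \in Wset n /\ forall p, same_class C (w p) p) (w \in WC n C).
Proof.
rewrite [w \in WC _ _]in_set; apply: (iffP andP) => -[Ww H]; split=> //.
  have wB p i : (i < size C)%N -> (w p \in block n C i) = (p \in block n C i).
    move=> lt_i; have /forallP/(_ (Ordinal lt_i))/eqP/= eqB := H.
    by rewrite -[in LHS]eqB mem_imset //; apply: perm_inj.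
  move=> p; apply/same_classP => i lt_i; rewrite wB //.
  by rewrite -(elimT (WsetP w) Ww) wB.
apply/forallP=> i; rewrite eqEcard card_imset ?leqnn ?andbT; last exact: perm_inj.
apply/subsetP=> _ /imsetP[p pB ->].
by have /same_classP/(_ i (ltn_ord i))[-> _] := H p.
Qed.

End Blocks.

(** * Roots, reflections and the sets X_C *)

Section Swap.

Variable n : nat.
Implicit Types p q r : sidx n.

(** The reflection in e_q - e_p.  When q = -p, both transpositions would
    coincide and cancel. *)
Definition root_perm p q : {perm sidx n} :=
  if q == sopp p then tperm p q else (tperm p q * tperm (sopp p) (sopp q))%g.

Lemma sopp_neq p : (sopp p == p) = false.
Proof. by case: p => [[] x]; apply/eqP; case. Qed.

Lemma sopp_eq p q : (sopp p == sopp q) = (p == q).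
Proof. exact: inj_eq (can_inj (@soppK n)) _ _. Qed.

Lemma sopp_eql p q : (sopp p == q) = (p == sopp q).
Proof. by rewrite -{1}(soppK q) sopp_eq. Qed.

Lemma root_permE p q r : p != q -> root_perm p q r =
  if r == p then q else if r == q then p else
  if r == sopp p then sopp q else if r == sopp q then sopp p else r.
Proof.
move=> neq_pq; rewrite /root_perm; case: eqP => [eq_q|/eqP neq].
  rewrite eq_q permE /= soppK; case: eqP => // _; case: eqP => // _.
rewrite permM !permE /=.
case: (r =P p) => [_|_].
  by rewrite (negbTE neq) eq_sym sopp_neq.
case: (r =P q) => [_|_] //.
by rewrite eq_sym sopp_neq -sopp_eql eq_sym (negbTE neq).
Qed.

Lemma root_perm_W p q : p != q -> root_perm p q \in Wset n.
Proof.
move=> neq_pq; apply/WsetP => r; rewrite !root_permE //.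
rewrite !sopp_eq !sopp_eql.
have /eqP := negbT (sopp_neq p); have /eqP := negbT (sopp_neq q).
have := soppK p; have := soppK q; have := soppK r.
case: (r =P p); case: (r =P q); case: (r =P sopp p); case: (r =P sopp q) => /=.
all: congruence.
Qed.

Lemma mem_root_perm C p q : is_scomp n C -> p != q ->
  (root_perm p q \in WC n C) = same_class C p q.
Proof.
move=> HC neq_pq; apply/(WCP HC)/idP => [[_ /(_ p)]|H].
  by rewrite root_permE // eqxx same_class_sym.
split; first exact: root_perm_W.
move=> r; rewrite root_permE //.
case: eqP => [->|_]; first by rewrite same_class_sym.
case: eqP => [->|_] //.
case: eqP => [->|_]; first by rewrite same_class_opp same_class_sym.
case: eqP => [->|_]; first by rewrite same_class_opp.
exact: same_class_refl.
Qed.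

End Swap.

Section Roots.

Variable n : nat.
Implicit Types p q r : sidx n.

Lemma evecE p i : evec p 0 i = (-1) ^+ p.1 * (i == p.2)%:R.
Proof. by rewrite !mxE eqxx /=. Qed.

Lemma evec_opp p : evec (sopp p) = - evec p.
Proof. by case: p => [[] x]; rewrite /evec /= ?expr0 ?expr1 ?scaleN1r ?scale1r ?opprK. Qed.

Lemma evec_inj : injective (@evec n).
Proof.
move=> p q /rowP/(_ p.2); rewrite !evecE eqxx mulr1.
case: p q => [b x] [c y] /=; case: (x =P y) => [->|_].
  by rewrite mulr1; case: b c => [] [].
by rewrite mulr0 => /eqP; rewrite signr_eq0.
Qed.

Lemma evec_mulmx p w : w \in Wset n -> evec p *m Wmx w = evec (w p).
Proof.
have H x : evec (false, x) *m Wmx w = evec (w (false, x)).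
  by rewrite /evec /= expr0 scale1r -rowE rowK.
case: p => [[] x] Ww //.
by rewrite -[(true, x)]/(sopp (false, x)) evec_opp mulNmx H (elimT (WsetP w) Ww) evec_opp.
Qed.

(** With e_(-p) = - e_p, all roots, long and short, have the single form
    e_q - e_p. *)
Lemma mem_roots (a : 'rV[rat]_n) : reflect
  (exists p q, p != q /\ a = evec q - evec p) (a \in type_C_roots n).
Proof.
rewrite mem_cat; apply: (iffP orP) => [[/mapP|/mapP]|].
- move=> [p _ ->]; exists (sopp p), p; rewrite sopp_neq; split=> //.
  by rewrite evec_opp opprK mulr2n.
- move=> [[p q]]; rewrite mem_filter /= => /andP[lt_pq _] ->.
  exists (sopp q), p; rewrite evec_opp opprK; split=> //.
  by apply/eqP=> eq_pq; move: lt_pq; rewrite -eq_pq /= ltnn.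
move=> [p [q [neq_pq ->]]].
have mem2 (r s : sidx n) : (r.2 < s.2)%N -> evec r + evec s \in [seq evec pq.1 + evec pq.2 |
    pq : sidx n * sidx n <- enum {: sidx n * sidx n} &
      (nat_of_ord pq.1.2 < nat_of_ord pq.2.2)%N].
  by move=> lt_rs; apply/mapP; exists (r, s) => //; rewrite mem_filter mem_enum /= lt_rs.
rewrite -evec_opp.
case: (ltngtP (sopp p).2 q.2) => [lt_pq|lt_qp|eq_pq].
- by right; rewrite addrC; apply: mem2.
- by right; apply: mem2.
left; have -> : sopp p = q.
  move: eq_pq neq_pq; case: p q => [b x] [c y] /= /val_inj ->.
  by rewrite /sopp xpair_eqE eqxx /= andbT; case: b c => [] [].
by rewrite -mulr2n; apply/mapP; exists q => //; rewrite mem_enum.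
Qed.

(** The sum of the entries of index at least i vanishes on all simple roots but
    the i-th, so that, up to a factor 2 for the root 2 e_1, it is the coordinate
    along the i-th simple root. *)
Definition tail_sum (v : 'rV[rat]_n) (m : nat) : rat := \sum_(j < n | (m <= j)%N) v 0 j.

Lemma tail_sum_recl v (j : 'I_n) : tail_sum v j = v 0 j + tail_sum v j.+1.
Proof.
rewrite /tail_sum (bigD1 j) //=; congr (_ + _); apply: eq_bigl => i.
by rewrite ltn_neqAle andbC eq_sym.
Qed.

Definition simple_coord (v : 'rV[rat]_n) (i : 'I_n) : rat :=
  if i == 0%N :> nat then tail_sum v i / 2 else tail_sum v i.

Lemma simple_sum v : v = \sum_i simple_coord v i *: simple_root i.
Proof.
apply/rowP=> j; rewrite summxE.
transitivity (\sum_(i < n) (tail_sum v i * (j == i)%:R - tail_sum v i * (i == j.+1 :> nat)%:R)).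
  rewrite sumrB (bigD1 j) //= eqxx mulr1 big1 ?addr0; last first.
    by move=> i /negbTE; rewrite eq_sym => ->; rewrite mulr0.
  rewrite tail_sum_recl; apply/esym/eqP; rewrite subr_eq; apply/eqP; congr (_ + _).
  case: (ltnP j.+1 n) => [lt_jn|le_nj].
    rewrite [RHS](bigD1 (Ordinal lt_jn)) //= eqxx mulr1 big1 ?addr0 // => i.
    by rewrite -val_eqE /= => /negbTE ->; rewrite mulr0.
  have -> : tail_sum v j.+1 = 0 by apply: big_pred0 => i; apply/negbTE; have := ltn_ord i; lia.
  rewrite big1 // => i _; case: eqP => [eq_i|_]; last by rewrite mulr0.
  by have := ltn_ord i; lia.
apply: eq_bigr => i _; rewrite mxE /simple_coord /simple_root.
case: (i =P 0%N :> nat) => [i0|/eqP i_n0].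
  rewrite mulr2n mxE !evecE /= expr0 !mul1r.
  by rewrite i0 /= mulr0 subr0; field.
rewrite !mxE /= !expr0 !mul1r mulrBr; congr (_ - _ * _%:R).
rewrite -val_eqE /=; have lt_in := ltn_ord i.
have -> : ((i + n).-1 = i.-1 + n)%N by lia.
by rewrite modnDr modn_small; lia.
Qed.

Lemma coord_simple v i : coord (simple_roots n) i v = simple_coord v i.
Proof.
have X_i (j : 'I_n) : (simple_roots n)`_j = simple_root j.
  by rewrite (nth_map j) ?size_enum_ord // nth_ord_enum.
have Xsum u : u = \sum_i simple_coord u i *: (simple_roots n)`_i.
  by rewrite {1}(simple_sum u); apply: eq_bigr => j _; rewrite X_i.
have Xfree : free (simple_roots n).
  have X_full : <<simple_roots n>>%VS = fullv.
    apply/vspaceP => u; rewrite memvf {1}(Xsum u).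
    apply: memv_suml => j _; apply/memvZ/memv_span/mem_nth.
    by rewrite size_tuple.
  by rewrite /free X_full dimvf size_tuple dim_matrix mul1r.
by rewrite {1}(Xsum v) coord_sum_free.
Qed.

Lemma pos_rootE a :
  pos_root a = (a \in type_C_roots n) && [forall i : 'I_n, 0 <= tail_sum a i].
Proof.
congr (_ && _); apply: eq_forallb => i; rewrite coord_simple /simple_coord.
by case: ifP => // _; rewrite pmulr_lge0.
Qed.

Lemma tail_sum_evec p m : tail_sum (evec p) m = (-1) ^+ p.1 * (m <= p.2)%:R.
Proof.
rewrite /tail_sum big_mkcond (bigD1 p.2) //= evecE eqxx big1 ?addr0.
  by case: ifP => _; rewrite ?mulr1 ?mulr0.
by move=> i /negbTE ne_i; rewrite evecE ne_i mulr0 if_same.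
Qed.

(** The tail sums of e_q - e_p compare those of the two signed points, and the
    tails starting at |p| and at |q| already decide the sign. *)
Lemma pos_evecB p q : p != q -> pos_root (evec q - evec p) = (signed_val p < signed_val q).
Proof.
move=> neq_pq; rewrite pos_rootE; have -> /= : evec q - evec p \in type_C_roots n.
  by apply/mem_roots; exists p, q.
have tailB (i : 'I_n) : (0 <= tail_sum (evec q - evec p) i) =
    ((-1) ^+ p.1 * (i <= p.2)%:R <= (-1) ^+ q.1 * (i <= q.2)%:R :> rat).
  rewrite -!tail_sum_evec -[RHS]subr_ge0; congr (Order.le _ _).
  by rewrite /tail_sum -sumrB; apply: eq_bigr => j _; rewrite !mxE.
have ne_pq : ~~ ((p.2 == q.2 :> nat) && (p.1 == q.1)).
  apply: contra neq_pq; case: p q {tailB} => [b x] [c y] /=.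
  by rewrite xpair_eqE andbC.
apply/forallP/idP => [H|lt_pq i].
  have := H p.2; have := H q.2; rewrite !tailB /signed_val !leqnn.
  case: p q {neq_pq H tailB} ne_pq => [b x] [c y] /=.
  case: b c => [] [] /=; rewrite ?expr0 ?expr1 ?mulN1r ?mul1r;
    case: (leqP x y) => le_xy; case: (leqP y x) => le_yx;
    rewrite ?andbT ?andbF ?lerN2 => //= ne; lia.
rewrite tailB; move: lt_pq; rewrite /signed_val {tailB neq_pq}.
case: p q ne_pq => [b x] [c y] /=.
by case: b c => [] [] /=; rewrite ?expr0 ?expr1 ?mulN1r ?mul1r => _ lt_pq;
    case: (leqP i x) => le_ix; case: (leqP i y) => le_iy => //; lia.
Qed.

Lemma dotvBr (a b c : 'rV[rat]_n) : dotv a (b - c) = dotv a b - dotv a c.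
Proof. by rewrite /dotv -sumrB; apply: eq_bigr => i _; rewrite !mxE mulrBr. Qed.

Lemma dotv_sym (a b : 'rV[rat]_n) : dotv a b = dotv b a.
Proof. by apply: eq_bigr => i _; rewrite mulrC. Qed.

Lemma dotv_evec p q : dotv (evec p) (evec q) = (p == q)%:R - (p == sopp q)%:R.
Proof.
rewrite /dotv (bigD1 p.2) //= !evecE eqxx mulr1 big1 ?addr0; last first.
  by move=> i /negbTE ne_i; rewrite evecE ne_i mulr0 mul0r.
case: p q => [b x] [c y] /=; rewrite !xpair_eqE /=.
by case: (x == y); case: b c => [] [] /=; rewrite ?expr0 ?expr1; ring.
Qed.

Lemma evec_refl p q r : p != q ->
  evec r *m refl_mx (evec q - evec p) = evec (root_perm p q r).
Proof.
move=> neq_pq; set a := _ - _.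
have -> : evec r *m refl_mx a = evec r - (2 * dotv (evec r) a / dotv a a) *: a.
  have row_refl i : delta_mx 0 i *m refl_mx a =
      delta_mx 0 i - (2 * dotv (delta_mx 0 i) a / dotv a a) *: a.
    by rewrite -rowE rowK.
  rewrite {1}/evec -scalemxAl row_refl scalerBr scalerA; congr (_ - _ *: _).
  have -> : dotv (evec r) a = (-1) ^+ r.1 * dotv (delta_mx 0 r.2) a.
    by rewrite /dotv mulr_sumr; apply: eq_bigr => i _; rewrite mxE mulrA.
  ring.
have -> : dotv a a = 2 * (1 + (p == sopp q)%:R).
  have dot1 r' : dotv (evec r') (evec r') = 1.
    by rewrite dotv_evec eqxx eq_sym sopp_neq subr0.
  have dotB (u v w : 'rV[rat]_n) : dotv (u - v) w = dotv u w - dotv v w.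
    by rewrite !(dotv_sym _ w) dotvBr.
  rewrite /a dotvBr !dotB !dot1 (dotv_sym (evec q)).
  by rewrite dotv_evec (negbTE neq_pq); case: (p == _) => /=; lra.
rewrite dotvBr !dotv_evec root_permE // /a.
have ne_op x : (x == sopp x) = false by rewrite eq_sym sopp_neq.
case: (r =P p) => [->|/eqP rp].
  rewrite (negbTE neq_pq) ne_op.
  have -> : 2 * (false%:R - (p == sopp q)%:R - (true%:R - false%:R))
      / (2 * (1 + (p == sopp q)%:R)) = -1 :> rat.
    by case: eqP => _ /=; field.
  by rewrite scaleN1r opprK addrC subrK.
case: (r =P q) => [->|/eqP rq].
  rewrite ne_op -sopp_eql (sopp_eql q).
  rewrite [q == sopp p]eq_sym sopp_eql.
  have -> : 2 * (true%:R - false%:R - (false%:R - (p == sopp q)%:R))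
      / (2 * (1 + (p == sopp q)%:R)) = 1 :> rat.
    by case: eqP => _ /=; field.
  by rewrite scale1r opprB addrC subrK.
case: (r =P sopp p) => [eq_r|/eqP rp'].
  have -> : (r == sopp q) = false by rewrite eq_r sopp_eq (negbTE neq_pq).
  have -> : (p == sopp q) = false by rewrite -sopp_eql -eq_r (negbTE rq).
  have -> : 2 * (false%:R - false%:R - (false%:R - true%:R))
      / (2 * (1 + false%:R)) = 1 :> rat by [].
  by rewrite eq_r !evec_opp scale1r opprB addrA addNr add0r.
case: (r =P sopp q) => [eq_r|/eqP rq'].
  have -> : (p == sopp q) = false by rewrite -eq_r eq_sym (negbTE rp).
  have -> : 2 * (false%:R - true%:R - (false%:R - false%:R))
      / (2 * (1 + false%:R)) = -1 :> rat by [].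
  by rewrite eq_r !evec_opp scaleN1r opprK addrA addNr add0r.
by rewrite !subrr mulr0 mul0r scale0r subr0.
Qed.

(** An element of W_C acting as the reflection sends p to q, which puts p and q
    in one class; conversely the reflection then stabilises all classes. *)
Lemma in_PhiC_evecB C p q : is_scomp n C -> p != q ->
  in_PhiC C (evec q - evec p) = same_class C p q.
Proof.
move=> HC neq_pq; rewrite /in_PhiC.
have -> /= : evec q - evec p \in type_C_roots n by apply/mem_roots; exists p, q.
apply/exists_inP/idP => [[w /(WCP HC)[Ww wC] /eqP w_refl]|same_pq].
  have <- : w p = q.
    apply: evec_inj; rewrite -evec_mulmx // w_refl evec_refl //.
    by rewrite root_permE ?eqxx.
  by rewrite same_class_sym.
exists (root_perm p q); first by rewrite mem_root_perm.
apply/eqP/row_matrixP => i; rewrite !rowE.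
have := evec_refl (false, i) neq_pq; rewrite -evec_mulmx ?root_perm_W //.
by rewrite /evec /= expr0 scale1r => ->.
Qed.

(** By [in_PhiC_evecB] and [pos_evecB], a positive root of W_C is a pair p < q in
    one class, and w keeps it positive when w p < w q.  From here on this
    replaces the definition by roots. *)
Lemma XCP C w : is_scomp n C -> reflect
  (w \in Wset n /\ forall p q, same_class C p q ->
     signed_val p < signed_val q -> signed_val (w p) < signed_val (w q))
  (w \in XC n C).
Proof.
move=> HC; rewrite [w \in XC _ _]in_set; apply: (iffP andP) => -[Ww].
  move=> /allP H; split=> // p q same_pq lt_pq.
  have neq_pq : p != q by apply: contraTneq lt_pq => ->; rewrite ltxx.
  rewrite -pos_evecB ?(inj_eq perm_inj) // -!evec_mulmx // -mulmxBl.
  apply: H; rewrite mem_filter in_PhiC_evecB // same_pq pos_evecB // lt_pq /=.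
  by apply/mem_roots; exists p, q.
move=> H; split=> //; apply/allP => a; rewrite mem_filter => /andP[/andP[Phi_a pos_a]].
move=> /mem_roots[p [q [neq_pq eq_a]]]; move: Phi_a pos_a.
rewrite eq_a in_PhiC_evecB // pos_evecB // mulmxBl !evec_mulmx //.
by rewrite pos_evecB ?(inj_eq perm_inj) //; apply: H.
Qed.

End Roots.

(** * Linear independence of the x_C *)

(** The length of the first part is the first place where the block changes,
    its sign is that of the first point, and the rest follows by shifting. *)
Lemma scomp_block_index_inj (C1 C2 : seq int) (N : nat) : is_scomp N C1 -> is_scomp N C2 ->
  (forall x y, (x < N)%N -> (y < N)%N ->
     (block_index C1 x == block_index C1 y) = (block_index C2 x == block_index C2 y)) ->
  (forall x, (x < N)%N -> (0 < C1`_(block_index C1 x)) = (0 < C2`_(block_index C2 x))) ->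
  C1 = C2.
Proof.
rewrite /is_scomp; elim: C1 C2 N => [|c C1 IHC] [|d C2] N //=.
- by move=> /eqP <- /andP[/andP[d0 _]]; lia.
- by move=> /andP[/andP[c0 _] /eqP <-] /eqP; lia.
move=> /andP[/andP[c0 nz1] /eqP sum1] /andP[/andP[d0 nz2] /eqP sum2] eq_blk eq_sgn.
have c_gt0 : (0 < `|c|)%N by lia.
have d_gt0 : (0 < `|d|)%N by lia.
have eq_abs : `|c|%N = `|d|%N.
  case: (ltngtP `|c|%N `|d|%N) => // lt_cd.
    by have := eq_blk 0%N `|c|%N; rewrite c_gt0 d_gt0 ltnn lt_cd /= => H; have := H _ _; lia.
  by have := eq_blk 0%N `|d|%N; rewrite c_gt0 d_gt0 ltnn lt_cd /= => H; have := H _ _; lia.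
have eq_cd : c = d.
  have := eq_sgn 0%N; rewrite c_gt0 d_gt0 /=; lia.
rewrite -eq_cd in nz2 sum2 eq_blk eq_sgn *; congr (_ :: _).
apply: (IHC _ (N - `|c|)%N).
- by rewrite nz1 /=; lia.
- by rewrite nz2 /=; lia.
- move=> x y lt_x lt_y.
  have := eq_blk (`|c| + x)%N (`|c| + y)%N.
  by rewrite !ltnNge !leq_addr /= !addKn !eqSS; apply; lia.
move=> x lt_x; have := eq_sgn (`|c| + x)%N.
by rewrite !ltnNge leq_addr /= addKn; apply; lia.
Qed.

Lemma scompP n (C : scomp n) : is_scomp n C.
Proof. by case: C. Qed.

Lemma same_class_inj n (C1 C2 : scomp n) :
  (forall p q : sidx n, same_class C1 p q = same_class C2 p q) -> C1 = C2.
Proof.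
move=> eq_same; apply/val_inj/(scomp_block_index_inj (scompP C1) (scompP C2)) =>
  [x y lt_x lt_y|x lt_x].
  have := eq_same (false, Ordinal lt_x) (false, Ordinal lt_y).
  by rewrite /same_class /= !andbT.
have := eq_same (true, Ordinal lt_x) (false, Ordinal lt_x).
by rewrite /same_class /= !eqxx.
Qed.

(** The relation is read off from the reflections contained in W_C. *)
Lemma eq_WC_same_class n C1 C2 : is_scomp n C1 -> is_scomp n C2 -> WC n C1 = WC n C2 ->
  forall p q : sidx n, same_class C1 p q = same_class C2 p q.
Proof.
move=> HC1 HC2 eqW p q; have [->|neq_pq] := eqVneq p q; first by rewrite !same_class_refl.
by rewrite -!mem_root_perm // eqW.
Qed.

(** Replaces an arbitrary injective key by its rank, so that a permutation may
    be specified by the relative order of its values only. *)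
Lemma rank_perm n (K : 'I_n -> nat) : injective K ->
  exists s : {perm 'I_n}, forall x y, (s x < s y)%N = (K x < K y)%N.
Proof.
move=> K_inj; pose A x := [set y | (K y < K x)%N].
have A_lt x : (#|A x| < n)%N.
  rewrite -[n in (_ < n)%N]card_ord -cardsT; apply/proper_card/properP; split.
    exact: subsetT.
  by exists x; rewrite ?inE // ltnn.
have A_mono x y : (K x < K y)%N -> (#|A x| < #|A y|)%N.
  move=> lt_xy; apply/proper_card/properP; split.
    by apply/subsetP=> z; rewrite !inE => /ltn_trans; apply.
  by exists x; rewrite !inE ?ltnn.
have f_inj : injective (fun x => Ordinal (A_lt x)).
  move=> x y /(congr1 val) /= eq_xy; case: (ltngtP (K x) (K y)) => [/A_mono|/A_mono|/K_inj//].
    by rewrite eq_xy ltnn.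
  by rewrite eq_xy ltnn.
exists (perm f_inj) => x y; rewrite !permE /=.
case: (ltngtP (K x) (K y)) => [/A_mono//|/A_mono lt_yx|/K_inj ->]; last by rewrite ltnn.
by rewrite ltnNge ltnW.
Qed.

Lemma signed_perm n (neg : 'I_n -> bool) (s : {perm 'I_n}) :
  exists2 w : {perm sidx n}, w \in Wset n & forall p, w p = (p.1 (+) neg p.2, s p.2).
Proof.
have f_inj : injective (fun p : sidx n => (p.1 (+) neg p.2, s p.2) : sidx n).
  move=> [b x] [c y] [/= eq_b /perm_inj eq_x].
  by move: eq_b; rewrite eq_x => /addIb ->.
exists (perm f_inj); last by move=> p; rewrite permE.
by apply/WsetP => p; rewrite !permE /sopp /= addNb.
Qed.

Lemma ltn_lex N a b x y : (x < N)%N -> (y < N)%N ->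
  (a * N + x < b * N + y)%N = (a < b)%N || (a == b) && (x < y)%N.
Proof.
move=> lt_x lt_y; case: (ltngtP a b) => [lt_ab|lt_ba|->] /=; last by rewrite ltn_add2l.
  by have := leq_mul lt_ab (leqnn N); rewrite mulSn; lia.
by have := leq_mul lt_ba (leqnn N); rewrite mulSn; lia.
Qed.

Section Extremal.

Variables (n : nat) (C : seq int).
Hypothesis HC : is_scomp n C.

(** At the end of a block such w descends, except when a negative block is
    followed by a positive one, where the signs force an increase. *)
Definition extremal (w : {perm sidx n}) :=
  (forall x : 'I_n, (0 < signed_val (w (false, x))) = (0 < C`_(block_index C x))) /\
  (forall x y : 'I_n, (block_index C x < block_index C y)%N ->
     (0 < C`_(block_index C x)) = (0 < C`_(block_index C y)) ->
     signed_val (w (false, y)) < signed_val (w (false, x))).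

(** The absolute values are ranked by a key in which the blocks matter first and
    the place inside the block second; on positive blocks, the absolute value
    decreases with the block and increases inside it, and the other way round
    on negative blocks. *)
Lemma ex_extremal : exists2 w, w \in XC n C & extremal w.
Proof.
pose pos (x : 'I_n) := 0 < C`_(block_index C x).
(* Doubling makes the keys of positive and of negative blocks distinct. *)
pose K x := if pos x then (((size C - block_index C x) * n + x).*2)%N
            else ((block_index C x * n + (n - x.+1)).*2.+1)%N.
have lt_rev (x : 'I_n) : (n - x.+1 < n)%N by have := ltn_ord x; lia.
have K_inj : injective K.
  move=> x y; rewrite /K; have lt_x := block_index_ord HC x; have lt_y := block_index_ord HC y.
  case: ifP => _; case: ifP => _ eqK.
  - have := ltn_lex (size C - block_index C x) (size C - block_index C y)
      (ltn_ord x) (ltn_ord y).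
    have := ltn_lex (size C - block_index C y) (size C - block_index C x)
      (ltn_ord y) (ltn_ord x).
    by move=> H1 H2; apply: val_inj => /=; lia.
  - by lia.
  - by lia.
  have := ltn_lex (block_index C x) (block_index C y) (lt_rev x) (lt_rev y).
  have := ltn_lex (block_index C y) (block_index C x) (lt_rev y) (lt_rev x).
  have := ltn_ord x; have := ltn_ord y.
  by move=> ? ? H1 H2; apply: val_inj => /=; lia.
have [s sK] := rank_perm K_inj.
have [w Ww wE] := signed_perm (fun x => ~~ pos x) s.
exists w; last split.
- apply/XCP => //; split=> // [[b x] [c y]]; rewrite /same_class /= => /andP[/eqP eq_i eq_b].
  have eq_pos : pos y = pos x by rewrite /pos eq_i.
  rewrite !wE /= eq_pos; have := sK x y; have := sK y x.
  rewrite /K eq_pos eq_i; move: eq_b; rewrite -/(pos x).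
  have lt_x := ltn_ord x; have lt_y := ltn_ord y.
  case: (pos x); rewrite /signed_val /= ?orbF ?orbT ?addbF.
    by case: b c => [] [] /=; lia.
  by move=> /eqP <-; case: b => /=; lia.
- by move=> x; rewrite wE /signed_val /= -/(pos x); case: (pos x) => /=; lia.
move=> x y lt_i; rewrite -/(pos x) -/(pos y) => eq_pos.
rewrite !wE /= -eq_pos; have := sK x y; have := sK y x.
have lt_x := block_index_ord HC x; have lt_y := block_index_ord HC y.
rewrite /K -eq_pos /signed_val; case: (pos x) => /=.
  have := ltn_lex (size C - block_index C y) (size C - block_index C x)
      (ltn_ord y) (ltn_ord x).
  by have := ltn_lex (size C - block_index C x) (size C - block_index C y)
      (ltn_ord x) (ltn_ord y); lia.
have := ltn_lex (block_index C y) (block_index C x) (lt_rev y) (lt_rev x).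
by have := ltn_lex (block_index C x) (block_index C y) (lt_rev x) (lt_rev y); lia.
Qed.

End Extremal.

Section Triangular.

Variable n : nat.

Definition possupp (C : seq int) : {set 'I_n} := [set x : 'I_n | 0 < C`_(block_index C x)].

Definition pairs (C : seq int) : {set sidx n * sidx n} := [set pq | same_class C pq.1 pq.2].

(** Encodes the lexicographic order on the two cardinals, the second being at
    most the number of all pairs. *)
Definition height (C : seq int) : nat :=
  (#|possupp C| * #|{: sidx n * sidx n}|.+1 + #|pairs C|)%N.

(** A positive block of C1 consists of points where w takes positive values, so
    it lies in the positive part of C.  When the positive parts agree, a block
    of C1 is an increasing run of w of constant sign, and hence cannot meet two
    blocks of C. *)
Lemma extremal_XC (C C1 : scomp n) w : extremal C w -> w \in XC n C1 ->
  C1 = C \/ (height C1 < height C)%N.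
Proof.
move=> [w_sgn w_desc] /(XCP _ (scompP C1))[/WsetP Ww w_mono].
have sub_supp : possupp C1 \subset possupp C.
  apply/subsetP=> x; rewrite !inE => x_pos.
  have := w_mono (true, x) (false, x); rewrite -[(true, x)]/(sopp (false, x)) Ww.
  rewrite -w_sgn /same_class /= eqxx x_pos /signed_val /= => /(_ isT).
  by case: (w _) => [[] y] /=; lia.
have [eq_supp|ne_supp] := eqVneq (possupp C1) (possupp C); last first.
  right; rewrite /height; have : (#|possupp C1| < #|possupp C|)%N.
    by apply/proper_card; rewrite properEneq ne_supp.
  have := max_card (pairs C1); have := max_card (pairs C).
  move: #|_| #|_| #|_| #|_| #|_| => a b c d e; nia.
have pos_eq (x : 'I_n) : (0 < C1`_(block_index C1 x)) = (0 < C`_(block_index C x)).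
  by have /setP/(_ x) := eq_supp; rewrite !inE.
have block_lt (x y : 'I_n) : (x < y)%N ->
    block_index C1 x = block_index C1 y -> block_index C x = block_index C y.
  move=> lt_xy eqi; apply/eqP; rewrite eqn_leq leq_block_index
    ?(scomp_sum (scompP C)) ?(ltnW lt_xy) //=.
  rewrite leqNgt; apply/negP => lt_i.
  have := w_desc _ _ lt_i; rewrite -!pos_eq eqi => /(_ erefl) /lt_gtF/negP; apply.
  by apply: w_mono; rewrite /same_class /= ?eqi ?eqxx //; rewrite /signed_val /=; lia.
have sub_same (p q : sidx n) : same_class C1 p q -> same_class C p q.
  rewrite {1}/same_class => /andP[/eqP eq_i H]; rewrite /same_class -pos_eq H andbT.
  by case: (ltngtP p.2 q.2) => [/block_lt->|/block_lt->|->].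
have sub_pairs : pairs C1 \subset pairs C.
  by apply/subsetP=> pq; rewrite !inE; apply: sub_same.
have [eq_pairs|ne_pairs] := eqVneq (pairs C1) (pairs C).
  by left; apply: same_class_inj => p q; have /setP/(_ (p, q)) := eq_pairs; rewrite !inE.
by right; rewrite /height eq_supp ltn_add2l; apply/proper_card; rewrite properEneq ne_pairs.
Qed.

End Triangular.

(** In a vanishing combination, evaluation at the extremal element of C isolates
    the coefficient of C once those of smaller height are known to be 0. *)
Lemma x_tuple_free (K : fieldType) n : free (x_tuple K n).
Proof.
apply/freeP => a sum0 i.
have nthX (j : 'I_#|{: scomp n}|) : (x_tuple K n)`_j = xC K n (enum_val j).
  by rewrite nth_codom.
suff main m (C : scomp n) : (height n C < m)%N -> a (enum_rank C) = 0.
  by rewrite -[i]enum_valK (main (height n (enum_val i)).+1).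
elim: m C => // m IHm C; rewrite ltnS => leCm.
have [w wX w_ext] := ex_extremal (scompP C).
have Ww : w \in Wset n by have /(XCP _ (scompP C))[] := wX.
have /ffunP/(_ (subg (Wgroup n) w)) := sum0.
rewrite sum_ffunE ffunE (bigD1 (enum_rank C)) //= big1 => [|j ne_j].
  by rewrite addr0 !ffunE nthX enum_rankK ffunE subgK // wX [_ *: _]mulr1.
rewrite !ffunE nthX ffunE subgK //.
have [wXj|_] := boolP (w \in XC n _); last exact: scaler0.
have [eq_j|lt_j] := extremal_XC w_ext wXj.
  by rewrite -eq_j enum_valK eqxx in ne_j.
by rewrite -[j]enum_valK IHm ?scale0r // (leq_trans lt_j).
Qed.

(** * Triangularity of the restriction *)

Lemma sumn_abs_nseqN1 m : sumn [seq `|b|%N | b <- nseq m (-1 : int)] = m.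
Proof. by rewrite map_nseq sumn_nseq mul1n. Qed.

Lemma block_index_nseqN1 m x : block_index (nseq m (-1)) x = minn x m.
Proof. by elim: m x => [|m IHm] [|x] //=; rewrite ?minn0 // IHm subn1 minnSS. Qed.

Lemma block_index_cat C1 C2 x : block_index (C1 ++ C2) x =
  if (x < sumn [seq `|b|%N | b <- C1])%N then block_index C1 x
  else (size C1 + block_index C2 (x - sumn [seq `|b|%N | b <- C1]))%N.
Proof.
elim: C1 x => [|c C1 IHC] x /=; first by rewrite subn0.
case: (ltnP x `|c|%N) => [lt_x|le_x]; first by rewrite ltn_addr.
rewrite IHC ltn_subLR // subnDA; by case: ifP.
Qed.

Section Restriction.

Variables n k : nat.
Hypotheses (k_gt0 : (0 < k)%N) (k_le_n : (k <= n)%N).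

Lemma Dcomp_scomp : is_scomp n (Dcomp n k).
Proof.
rewrite /is_scomp /= sumn_abs_nseqN1 subnKC // eqxx andbT.
by apply/andP; split; [lia | apply/allP=> c /nseqP[-> _]].
Qed.

Lemma same_class_Dcomp (p q : sidx n) :
  same_class (Dcomp n k) p q = (p == q) || (p.2 < k)%N && (q.2 < k)%N.
Proof.
case: p q => [b x] [c y]; rewrite xpair_eqE -val_eqE /same_class /= !block_index_nseqN1.
have := ltn_ord x; have := ltn_ord y.
case: (ltnP x k) => lt_x; case: (ltnP y k) => lt_y lt_yn lt_xn /=.
- by rewrite ltz_nat k_gt0 !orbT.
- have /negbTE -> : x != y :> nat by lia.
  by rewrite andbF.
- have /negbTE -> : x != y :> nat by lia.
  by rewrite andbF.
have lt_min : (minn (x - k) (n - k) < n - k)%N by lia.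
by rewrite nth_nseq lt_min !orbF andbC; congr (_ && _); apply/eqP/eqP; lia.
Qed.

(** The embedding of W_k in W_n as W_D, on the level of compositions. *)
Definition pad (C : seq int) : seq int := C ++ nseq (n - k) (-1).

Lemma pad_scomp C : is_scomp k C -> is_scomp n (pad C).
Proof.
rewrite /is_scomp /pad all_cat map_cat sumn_cat sumn_abs_nseqN1.
move=> /andP[-> /eqP->]; rewrite subnKC // eqxx andbT.
by apply/allP=> c /nseqP[-> _].
Qed.

Lemma same_class_pad_Dcomp C (p q : sidx n) : is_scomp k C ->
  same_class (pad C) p q -> same_class (Dcomp n k) p q.
Proof.
move=> HC; rewrite same_class_Dcomp.
case: p q => [b x] [c y]; rewrite xpair_eqE -val_eqE.
have := ltn_ord x; have := ltn_ord y.
have block_lt z : (z < k)%N -> (block_index C z < size C)%N.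
  by move=> lt_z; apply: block_index_lt; rewrite (scomp_sum HC).
rewrite /same_class !block_index_cat (scomp_sum HC) !block_index_nseqN1 /=.
case: (ltnP x k) => lt_x; case: (ltnP y k) => lt_y lt_yn lt_xn /=.
- by rewrite orbT.
- by have := block_lt _ lt_x; lia.
- by have := block_lt _ lt_y; lia.
rewrite nth_cat ltnNge leq_addr /= addKn.
have lt_min : (minn (x - k) (n - k) < n - k)%N by lia.
by rewrite nth_nseq lt_min /= !orbF => /andP[/eqP eq_i ->] /=; apply/eqP; lia.
Qed.

Lemma pad_inj (C1 C2 : scomp k) :
  (forall p q : sidx n, same_class (pad C1) p q = same_class (pad C2) p q) -> C1 = C2.
Proof.
move=> eq_same; apply: val_inj => /=.
have := @same_class_inj n (SComp (pad_scomp (scompP C1)))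
  (SComp (pad_scomp (scompP C2))) eq_same.
move/(congr1 val) => /= eq_ext.
have eq_sz : size C1 = size C2.
  by have := congr1 size eq_ext; rewrite !size_cat => /addIn.
by have /eqP := eq_ext; rewrite eqseq_cat // => /andP[/eqP].
Qed.

Section Shift.

Variable d : {perm sidx n}.
Hypothesis dX : d \in XC n (Dcomp n k).

Let Wd (p : sidx n) : d (sopp p) = sopp (d p).
Proof. by have /(XCP _ Dcomp_scomp)[/WsetP] := dX. Qed.

Let d_mono (p q : sidx n) : (p.2 < k)%N -> (q.2 < k)%N ->
  signed_val p < signed_val q -> signed_val (d p) < signed_val (d q).
Proof.
move=> p_k q_k; have /(XCP _ Dcomp_scomp)[_ H] := dX.
by apply: H; rewrite same_class_Dcomp p_k q_k orbT.
Qed.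

Lemma XD_positive (x : 'I_n) : (x < k)%N -> (d (false, x)).1 = false.
Proof.
move=> x_k; have := @d_mono (true, x) (false, x) x_k x_k.
rewrite -[(true, x)]/(sopp (false, x)) Wd.
by case: (d _) => [[] y]; rewrite /signed_val //= => /(_ _); lia.
Qed.

(** The values of d at 1, ..., k are positive and strictly increasing, hence the
    i-th is at least i. *)
Lemma XD_expand (p : sidx n) : (p.2 < k)%N -> (p.2 <= (d p).2)%N.
Proof.
suff pos_x (x : 'I_n) : (x < k)%N -> (x <= (d (false, x)).2)%N.
  case: p => [[] x] /pos_x //=.
  by rewrite -[(true, x)]/(sopp (false, x)) Wd.
case: x => m; elim: m => [//|m IHm] lt_mn /= lt_mk.
have lt_m : (m < n)%N by apply: ltnW.
have := IHm lt_m (ltnW lt_mk) => /=.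
have := @d_mono (false, Ordinal lt_m) (false, Ordinal lt_mn) (ltnW lt_mk) lt_mk.
rewrite /signed_val /= !XD_positive //=; last exact: ltnW.
by move=> /(_ _); lia.
Qed.

Lemma XD_fixed (p : sidx n) : (p.2 < k)%N -> (d p).2 = p.2 -> d p = p.
Proof.
suff pos_x (x : 'I_n) : (x < k)%N -> (d (false, x)).2 = x -> d (false, x) = (false, x).
  case: p => [[] x] /pos_x //=.
  by rewrite -[(true, x)]/(sopp (false, x)) Wd => H /H ->.
by move=> /XD_positive; case: (d _) => b y /= -> ->.
Qed.

End Shift.

Definition offdiag (C : seq int) : {set sidx n * sidx n} :=
  [set pq | (pq.1 != pq.2) && same_class C pq.1 pq.2].

(** The diagonal is left out so that only points moved by W_C count; these are
    the points where d is known to expand. *)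
Definition moved_weight (C : seq int) : nat := (\sum_(pq in offdiag C) pq.1.2.+1)%N.

Lemma same_class_offdiag C (p q : sidx n) :
  same_class C p q = (p == q) || ((p, q) \in offdiag C).
Proof. by rewrite inE /=; case: eqP => [->|_]; rewrite ?same_class_refl. Qed.

Lemma leq_sum_subset (T : finType) (A B : {set T}) (f : T -> nat) :
  A \subset B -> (\sum_(x in A) f x <= \sum_(x in B) f x)%N.
Proof. by move=> /setIidPr sAB; rewrite [X in (_ <= X)%N](big_setID A) /= sAB leq_addr. Qed.

(** The map d sends pairs in one class of C1 to pairs in one class of C, and
    all points of such pairs have absolute value at most k, where d expands. *)
Lemma Mackey_weight_lt C1 C d : is_scomp n C1 -> is_scomp n C -> d \in XC n (Dcomp n k) ->
  WC n C1 = (WC n C :^ d^-1)%g :&: WC n (Dcomp n k) ->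
  (forall p q : sidx n, same_class C1 p q = same_class C p q) \/
  (moved_weight C1 < moved_weight C)%N.
Proof.
move=> HC1 HC dX eqW.
have off1 pq : pq \in offdiag C1 -> ((d pq.1, d pq.2) \in offdiag C) && (pq.1.2 < k)%N.
  case: pq => p q; rewrite [_ \in offdiag C1]inE /= => /andP[neq_pq].
  rewrite -(mem_root_perm HC1 neq_pq) eqW inE mem_conjgV (mem_root_perm Dcomp_scomp neq_pq).
  move=> /andP[/(WCP HC)[_ /(_ (d p))]].
  rewrite permM permM permK root_permE // eqxx
     same_class_sym same_class_Dcomp (negbTE neq_pq) /=.
  by move=> same_d /andP[-> _]; rewrite inE /= (inj_eq perm_inj) neq_pq same_d.
have off_sym pq : pq \in offdiag C1 -> (pq.2, pq.1) \in offdiag C1.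
  by rewrite !inE /= eq_sym same_class_sym.
(* Either d fixes all points moved by W_C1, and then W_C1 is contained in W_C,
   or the weight strictly increases at some pair. *)
have [/forall_inP fix1|] := boolP [forall pq in offdiag C1, d pq.1 == pq.1].
  have sub1 : offdiag C1 \subset offdiag C.
    apply/subsetP=> -[p q] pq1; have /andP[] := off1 _ pq1.
    by rewrite (eqP (fix1 _ pq1)) (eqP (fix1 _ (off_sym _ pq1))).
  have [eq_off|ne_off] := eqVneq (offdiag C1) (offdiag C).
    by left=> p q; rewrite !same_class_offdiag eq_off.
  right; have /properP[_ [pq pqC pq1]] : offdiag C1 \proper offdiag C.
    by rewrite properEneq ne_off.
  rewrite /moved_weight [X in (_ < X)%N](big_setID (offdiag C1)) /= (setIidPr sub1).
  rewrite -[X in (X < _)%N]addn0 ltn_add2l (bigD1 pq) ?addSn //.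
  by rewrite in_setD pq1.
move=> /forall_inPn[pq0 pq01 ne0]; right.
apply: (@leq_trans (\sum_(pq in offdiag C1) (d pq.1).2.+1)%N).
  have le1 pq : pq \in offdiag C1 -> (pq.1.2 <= (d pq.1).2)%N.
    by move=> /off1/andP[_]; apply: XD_expand.
  rewrite /moved_weight (bigD1 pq0) //= [X in (_ < X)%N](bigD1 pq0) //= -addSn.
  apply: leq_add; last by apply: leq_sum => pq /andP[/le1].
  rewrite ltnS ltn_neqAle le1 // andbT; apply: contra ne0 => /eqP/val_inj eq2.
  by apply/eqP; apply: (XD_fixed dX) => //; have /andP[] := off1 _ pq01.
have dd_inj : injective (fun pq : sidx n * sidx n => (d pq.1, d pq.2)).
  by move=> [p q] [r s] [/perm_inj-> /perm_inj->].
have sub_off : (fun pq => (d pq.1, d pq.2)) @: offdiag C1 \subset offdiag C.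
  by apply/subsetP=> _ /imsetP[pq /off1/andP[? _] ->].
rewrite /moved_weight.
apply: leq_trans (leq_sum_subset (fun pq : sidx n * sidx n => (pq.1.2).+1) sub_off).

by rewrite big_imset //= => ? ? _ _; apply: dd_inj.
Qed.

Lemma mem1_XCD C : is_scomp n C -> 1%g \in XCD n C (Dcomp n k).
Proof.
move=> HC; have one_X C1 : is_scomp n C1 -> 1%g \in XC n C1.
  move=> HC1; apply/XCP => //; split; first exact: (group1 (Wgroup n)).
  by move=> p q; rewrite !perm1.
by rewrite inE mem_invg invg1 !one_X ?Dcomp_scomp.
Qed.

Lemma Cd_cases (C : scomp k) d C1 : d \in XCD n (pad C) (Dcomp n k) ->
  @Cd n k (pad C) d = Some C1 -> C1 = C \/ (moved_weight (pad C1) < moved_weight (pad C))%N.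
Proof.
rewrite /Cd inE => /andP[_ dX]; case: pickP => //= C2 /eqP eqW [<-].
have [|eq_same|] := Mackey_weight_lt (pad_scomp (scompP C2)) (pad_scomp (scompP C)) dX.
- exact: eqW.
- by left; apply: pad_inj.
by right.
Qed.

(** W_(C+) is contained in W_D, and it determines C. *)
Lemma Cd1 (C : scomp k) : @Cd n k (pad C) 1%g = Some C.
Proof.
have W1 : WC n (pad C) = (WC n (pad C) :^ 1^-1)%g :&: WC n (Dcomp n k).
  rewrite invg1 conjsg1; apply/esym/setIidPl/subsetP => w.
  move=> /(WCP (pad_scomp (scompP C)))[Ww Hw]; apply/(WCP Dcomp_scomp); split=> // p.
  exact: same_class_pad_Dcomp (scompP C) (Hw p).
rewrite /Cd; case: pickP => [C1 /eqP eqW|/(_ C)]; last by rewrite {1}W1 eqxx.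
congr Some; apply: pad_inj; apply: eq_WC_same_class; rewrite ?pad_scomp ?scompP //.
by rewrite eqW -W1.
Qed.

Section Span.

Variable K : fieldType.
Hypothesis charK0 : [pchar K] =i pred0.

Definition res_tuple : #|{: scomp n}|.-tuple (KW K k) :=
  codom_tuple (fun C : scomp n => resC K n k C).

(** The d with C_d = C contribute a positive multiple of x_C, as d = 1 is one of
    them, and all others are handled by induction on the weight. *)
Lemma xC_span_res (C : scomp k) : xC K k C \in <<res_tuple>>%VS.
Proof.
have [m] := ubnP (moved_weight (pad C)); elim: m C => // m IHm C; rewrite ltnS => leCm.
have extP := pad_scomp (scompP C).
have : resC K n k (pad C) \in <<res_tuple>>%VS.
  by apply: memv_span; apply: (codom_f (fun C : scomp n => resC K n k C) (SComp extP)).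
rewrite /resC (bigID (fun d => @Cd n k (pad C) d == Some C)) /= => res_in.
have rest_in : \sum_(d in XCD n (pad C) (Dcomp n k) | @Cd n k (pad C) d != Some C)
    (if @Cd n k (pad C) d is Some C1 then xC K k C1 else 0) \in <<res_tuple>>%VS.
  apply: memv_suml => d /andP[dX]; case Ed: (Cd _ _ d) => [C1|] ne_C; last exact: mem0v.
  have [eq_C|lt_C1] := Cd_cases dX Ed; first by rewrite eq_C eqxx in ne_C.
  by apply: IHm; apply: leq_trans lt_C1 leCm.
move: res_in; rewrite rpredDr //.
rewrite (eq_bigr (fun=> xC K k C)) => [|d /andP[_ /eqP ->] //].
rewrite sumr_const -scaler_nat rpredZeq.
rewrite ((pcharf0P _).1 charK0) -leqn0 leqNgt => /orP[/negP[]|//].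
by apply/card_gt0P; exists 1%g; rewrite unfold_in /= mem1_XCD //= Cd1.
Qed.

Lemma resC_MR C : resC K n k C \in MR K k.
Proof.
apply: memv_suml => d _; case: (Cd _ _ _) => [C1|]; last exact: mem0v.
exact/memv_span/codom_f.
Qed.

(** Expand y in the elements resC C and keep the same coefficients on the x_C;
    the x_C being independent, the coordinates used by Res return them. *)
Lemma Res_surjective (y : subvs_of (MR K k)) : exists x : subvs_of (MR K n), @Res K n k x = y.
Proof.
have y_span : vsval y \in <<res_tuple>>%VS.
  apply: subvP (subvsP y); apply/span_subvP => _ /codomP[C ->].
  exact: xC_span_res.
pose a i := coord res_tuple i (vsval y).
pose v := \sum_i a i *: (x_tuple K n)`_i.
have v_MR : v \in MR K n.
  by apply: memv_suml => i _; apply/memvZ/memv_span/mem_nth; rewrite size_tuple.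
have vK : vsval (vsproj (MR K n) v) = v by rewrite vsprojK.
exists (vsproj (MR K n) v); apply: val_inj; rewrite /Res /= vK vsprojK.
  rewrite [RHS](coord_span y_span).
  rewrite (reindex (@enum_val _ {: scomp n})) /=; last exact/onW_bij/enum_val_bij.
  apply: eq_bigr => i _; rewrite enum_valK coord_sum_free ?x_tuple_free //.
  by rewrite nth_codom.
by apply: memv_suml => C _; apply: memvZ; apply: resC_MR.
Qed.

End Span.
End Restriction.

Theorem proposition5p7 (K : fieldType) (charK0 : [pchar K]%R =i pred0)
    (n k : nat) (k_gt0 : (1 <= k)%N) (k_le_n : (k <= n)%N) :
  forall y : subvs_of (MR K k), exists x : subvs_of (MR K n), @Res K n k x = y.
Proof. exact: Res_surjective. Qed.
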